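(* Let $n$ be a positive integer with $n\not\equiv 1\pmod 3$. Then the ideal generating function of the numerical semigroup $\langle 3,n+2,2n+1\rangle$ is \[I(3,n+2,2n+1;q)=\frac{1}{1-q^3}\left(1+\frac{q\left(q^{n+1}-1\right)\left(2q^{n+3}+q^2-2q-1\right)-q^4\left(q^{2n+1}-q^{n+1}-q^n+1\right)}{(1-q)^2(1+q)}-q^{2n+2}\right).\]
   Context: $\langle 3,n+2,2n+1\rangle=\{3x+(n+2)y+(2n+1)z: x,y,z\in\mathbb{N}\}$. A non-empty set $I\subseteq S$ is an ideal of the numerical semigroup $S$ if $I+S\subseteq I$; its codimension is $\operatorname{codim}(I)=|S\setminus I|$. The ideal generating function is the formal power series $\sum_I q^{\operatorname{codim}(I)}$ over all ideals $I$ of $S$. *)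

(* Defs.v *)
From HB Require Import structures.
From mathcomp Require Import all_boot all_order all_algebra.
From mathcomp Require Import finmap zify.
From mathcomp Require Import mathcomp_extra boolp classical_sets functions.
From mathcomp Require Import cardinality.

Set Implicit Arguments.
Unset Strict Implicit.
Unset Printing Implicit Defensive.

Import Order.TTheory GRing.Theory Num.Theory.

Local Open Scope classical_set_scope.
Local Open Scope ring_scope.

Record fps (R : Type) := FPS { fps_coef : nat -> R }.

HB.instance Definition _ (R : Type) := gen_eqMixin (fps R).
HB.instance Definition _ (R : Type) := gen_choiceMixin (fps R).

Lemma fpsP (R : Type) (f g : fps R) : fps_coef f =1 fps_coef g -> f = g.
Proof. by case: f g => [f] [g] /= /funext ->. Qed.

Section Zmodule.
Variable R : zmodType.
Implicit Types f g : fps R.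

Definition fps_zero : fps R := FPS (fun=> 0).
Definition fps_opp f : fps R := FPS (fun k => - fps_coef f k).
Definition fps_add f g : fps R := FPS (fun k => fps_coef f k + fps_coef g k).

Fact fps_addA : associative fps_add.
Proof. by move=> f g h; apply: fpsP => k /=; rewrite addrA. Qed.
Fact fps_addC : commutative fps_add.
Proof. by move=> f g; apply: fpsP => k /=; rewrite addrC. Qed.
Fact fps_add0 : left_id fps_zero fps_add.
Proof. by move=> f; apply: fpsP => k /=; rewrite add0r. Qed.
Fact fps_addN : left_inverse fps_zero fps_opp fps_add.
Proof. by move=> f; apply: fpsP => k /=; rewrite addNr. Qed.

HB.instance Definition _ :=
  GRing.isZmodule.Build (fps R) fps_addA fps_addC fps_add0 fps_addN.

Lemma fps_coef0 k : fps_coef (0 : fps R) k = 0. Proof. by []. Qed.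
Lemma fps_coefN f k : fps_coef (- f) k = - fps_coef f k. Proof. by []. Qed.
Lemma fps_coefD f g k : fps_coef (f + g) k = fps_coef f k + fps_coef g k.
Proof. by []. Qed.
Lemma fps_coefB f g k : fps_coef (f - g) k = fps_coef f k - fps_coef g k.
Proof. by []. Qed.

End Zmodule.

Section Ring.
Variable R : comNzRingType.
Implicit Types f g : fps R.

Definition fps_one : fps R := FPS (fun k => (k == 0%N)%:R).
Definition fps_mul f g : fps R :=
  FPS (fun k => \sum_(i < k.+1) fps_coef f i * fps_coef g (k - i)%N).

Let trunc n f : {poly R} := \poly_(i < n) fps_coef f i.

Let coef_mul_trunc f g k n : (k < n)%N ->
  fps_coef (fps_mul f g) k = (trunc n f * trunc n g)`_k.
Proof.
move=> kn; rewrite coefM /=; apply: eq_bigr => i _; have ik := ltn_ord i.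
by rewrite !coef_poly !ifT //; lia.
Qed.

Fact fps_mulC : commutative fps_mul.
Proof.
by move=> f g; apply: fpsP => k; rewrite !(@coef_mul_trunc _ _ k k.+1)// mulrC.
Qed.

Fact fps_mulA : associative fps_mul.
Proof.
move=> f g h; apply: fpsP => k.
transitivity (trunc k.+1 f * trunc k.+1 g * trunc k.+1 h)`_k.
  rewrite -mulrA coefM /=; apply: eq_bigr => i _; have ik := ltn_ord i.
  rewrite coef_poly ltn_ord -(@coef_mul_trunc g h) //; lia.
rewrite coefM /=; apply: eq_bigr => i _; have ik := ltn_ord i.
by rewrite coef_poly ifT -?(@coef_mul_trunc f g) //; lia.
Qed.

Fact fps_mul1 : left_id fps_one fps_mul.
Proof.
move=> f; apply: fpsP => k /=.
rewrite big_ord_recl /= mul1r subn0 big1 ?addr0 // => i _.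
by rewrite mul0r.
Qed.

Fact fps_mulDl : left_distributive fps_mul +%R.
Proof.
move=> f g h; apply: fpsP => k /=; rewrite -big_split /=.
by apply: eq_bigr => i _; rewrite mulrDl.
Qed.

Fact fps_one_neq0 : fps_one != 0.
Proof.
apply/eqP => /(congr1 (fun f => fps_coef f 0%N)) /= /eqP.
by rewrite oner_eq0.
Qed.

HB.instance Definition _ := GRing.Zmodule_isComNzRing.Build (fps R)
  fps_mulA fps_mulC fps_mul1 fps_mulDl fps_one_neq0.

Definition fpsX : fps R := FPS (fun k => (k == 1%N)%:R).

Lemma fps_coef1 k : fps_coef (1 : fps R) k = (k == 0%N)%:R.
Proof. by []. Qed.
Lemma fps_coefM f g k :
  fps_coef (f * g) k = \sum_(i < k.+1) fps_coef f i * fps_coef g (k - i)%N.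
Proof. by []. Qed.

Lemma fps_coefXM f k :
  fps_coef (fpsX * f) k = if k is j.+1 then fps_coef f j else 0.
Proof.
rewrite fps_coefM big_ord_recl /= mul0r add0r.
case: k => [|k]; first by rewrite big_ord0.
rewrite big_ord_recl /= mul1r subn1 /= big1 ?addr0 // => i _.
by rewrite mul0r.
Qed.

Lemma fps_coefXn n k : fps_coef (fpsX ^+ n) k = (k == n)%:R.
Proof.
elim: n k => [|n IHn] k; first by rewrite expr0.
by rewrite exprS fps_coefXM; case: k => // k; rewrite IHn eqSS.
Qed.

End Ring.

Section UnitRing.
Variable R : comUnitRingType.
Implicit Types f g : fps R.

(* Solves [inv f * f = 1] for the coefficients in turn: [fps_inv_seq f m]
   lists the first [m] coefficients of the inverse. *)
Fixpoint fps_inv_seq f (m : nat) : seq R :=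
  if m is k.+1 then
    let s := fps_inv_seq f k in
    rcons s (((k == 0%N)%:R - \sum_(i < k) s`_i * fps_coef f (k - i)%N)
               / fps_coef f 0%N)
  else [::].

(* Units are the series with invertible constant term; elsewhere the inverse
   is the identity, as MathComp's [unitRingType] requires. *)
Definition fps_unit : {pred fps R} :=
  [pred f : fps R | fps_coef f 0%N \is a GRing.unit].
Definition fps_inv f : fps R :=
  if f \in fps_unit then FPS (fun k => (fps_inv_seq f k.+1)`_k) else f.

Let size_inv_seq f m : size (fps_inv_seq f m) = m.
Proof. by elim: m => //= m IHm; rewrite size_rcons IHm. Qed.

Let nth_inv_seq f m i :
  (i < m)%N -> (fps_inv_seq f m)`_i = (fps_inv_seq f i.+1)`_i.
Proof.
elim: m => // m IHm; rewrite ltnS leq_eqVlt => /predU1P[-> //|im].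
by rewrite -IHm //= nth_rcons size_inv_seq im.
Qed.

Fact fps_mulVx : {in fps_unit, left_inverse 1 fps_inv *%R}.
Proof.
move=> f uf; have u0 : fps_coef f 0%N \is a GRing.unit by [].
apply: fpsP => k; rewrite /fps_inv uf fps_coefM big_ord_recr.
rewrite [fps_coef (FPS _) _]/= nth_rcons size_inv_seq ltnn eqxx.
rewrite subnn divrK //.
have -> : \sum_(i < k) fps_coef (FPS (fun k0 => (fps_inv_seq f k0.+1)`_k0))
    (widen_ord (leqnSn k) i) * fps_coef f (k - widen_ord (leqnSn k) i)%N
  = \sum_(i < k) (fps_inv_seq f k)`_i * fps_coef f (k - i)%N.
  by apply: eq_bigr => i _; rewrite [in RHS]nth_inv_seq.
by rewrite /= addrC subrK.
Qed.

Fact fps_unitPl f g : g * f = 1 -> fps_unit f.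
Proof.
move=> /(congr1 (fun h => fps_coef h 0%N)).
rewrite fps_coefM big_ord_recl big_ord0 addr0 /= => gf1.
by apply/unitrPr; exists (fps_coef g 0%N); rewrite mulrC.
Qed.

Fact fps_inv_out : {in [predC fps_unit], fps_inv =1 id}.
Proof. by move=> f; rewrite inE /= /fps_inv => /negbTE ->. Qed.

HB.instance Definition _ := GRing.ComNzRing_hasMulInverse.Build (fps R)
  fps_mulVx fps_unitPl fps_inv_out.

Lemma fps_unitE f :
  (f \is a GRing.unit) = (fps_coef f 0%N \is a GRing.unit).
Proof. by []. Qed.

End UnitRing.

Definition numerical_semigroup (S : set nat) : Prop :=
  [/\ S 0%N, forall x y, S x -> S y -> S (x + y)%N & finite_set (~` S)].

Definition semigroup3 (a b c : nat) : set nat :=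
  [set s | exists x y z : nat, s = (a * x + b * y + c * z)%N].

Definition is_ideal (S I : set nat) : Prop :=
  [/\ I !=set0, I `<=` S & forall x s, I x -> S s -> I (x + s)%N].

(* [fset_set] sends infinite sets to [fset0]; for ideals of numerical
   semigroups this never happens, see [finite_codim]. *)
Definition codim (S I : set nat) : nat := #|` fset_set (S `\` I)|.

(* The sum of [q ^ codim I] over all ideals [I], collected by powers of [q];
   the number of ideals of given codimension is finite, see
   [finite_ideals_codim]. *)
Definition ideal_gf (S : set nat) : fps int :=
  FPS (fun k => #|` fset_set [set I | is_ideal S I /\ codim S I = k]|%:Z).

Section Finiteness.
Variable S : set nat.
Hypothesis S_ns : numerical_semigroup S.

Lemma numerical_semigroup_conductor :
  exists c, forall x, (c <= x)%N -> S x.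
Proof.
case: S_ns => _ _ fS.
exists (\max_(x <- fset_set (~` S)) x).+1 => x cx.
apply: contrapT => nSx.
have xS : x \in fset_set (~` S) by rewrite in_fset_set // inE.
by move: cx; rewrite ltnNge (@leq_bigmax_seq _ _ xpredT id).
Qed.

Lemma finite_codim I : is_ideal S I -> finite_set (S `\` I).
Proof.
move=> [[i Ii] _ IS]; have [c cS] := numerical_semigroup_conductor.
apply: (@sub_finite_set _ _ `I_(i + c)); last exact: finite_II.
move=> x [_ nIx] /=; rewrite ltnNge; apply/negP => icx; apply: nIx.
have -> : x = (i + (x - i))%N by lia.
by apply: IS => //; apply: cS; lia.
Qed.

Lemma finite_ideals_codim k :
  finite_set [set I | is_ideal S I /\ codim S I = k].
Proof.
have [c cS] := numerical_semigroup_conductor.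
pose n := (c.*2 + k)%N.
(* if [I] misses [x], it misses every [y] with [c <= y <= x - c] *)
have SI_lt I x : is_ideal S I -> codim S I = k -> (S `\` I) x -> (x < n)%N.
  move=> idI cI [Sx nIx]; rewrite ltnNge; apply/negP => nx.
  have fin := finite_codim idI; case: idI => _ _ IS.
  pose A := [fset (c + nat_of_ord i)%N | i : 'I_k.+1]%fset.
  have : (A `<=` fset_set (S `\` I))%fset.
    apply/fsubsetP => _ /imfsetP [i _ ->]; rewrite in_fset_set // inE /=.
    have ik := ltn_ord i; split; first by apply: cS; lia.
    move=> Iy; apply: nIx.
    have -> : x = (c + i + (x - (c + i)))%N by rewrite /n in nx; lia.
    by apply: IS => //; apply: cS; rewrite /n in nx; lia.
  move=> /fsubset_leq_card; rewrite -/(codim S I) cI card_imfset /=.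
    by rewrite -cardE card_ord ltnn.
  by move=> i j /addnI /val_inj.
apply: (@sub_finite_set _ _
  ((fun B : {set 'I_n} => S `\` [set x | exists2 i, i \in B & x = val i])
    @` setT)); last first.
  exact: finite_image.
move=> I [idI cI]; exists [set i : 'I_n | `[< (S `\` I) (val i) >]]%SET => //.
have IsubS : I `<=` S by case: idI.
apply/seteqP; split => x /=.
  move=> [Sx nx]; apply: contrapT => nIx; apply: nx.
  have xn : (x < n)%N by apply: SI_lt idI cI _; split.
  by exists (Ordinal xn); rewrite ?inE //; apply/asboolP; split.
move=> Ix; split; first exact: IsubS.
by move=> [i]; rewrite inE => /asboolP [_ nIi] xi; apply: nIi; rewrite -xi.
Qed.

End Finiteness.

Lemma numerical_semigroup3 n : (n %% 3 <> 1)%N ->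
  numerical_semigroup (semigroup3 3 (n + 2) (2 * n + 1)).
Proof.
move=> n3; split.
- by exists 0%N, 0%N, 0%N; rewrite !muln0.
- move=> _ _ [x [y [z ->]]] [x' [y' [z' ->]]].
  by exists (x + x')%N, (y + y')%N, (z + z')%N; lia.
- apply: (@sub_finite_set _ _ `I_(2 * n + 2)); last exact: finite_II.
  move=> s /= nS; rewrite ltnNge; apply/negP => ns; apply: nS.
  have [s0|[s1|s2]] : (s %% 3 = 0 \/ (s %% 3 = (n + 2) %% 3 \/
    s %% 3 = (2 * n + 1) %% 3))%N by lia.
  + by exists (s %/ 3)%N, 0%N, 0%N; lia.
  + by exists ((s - (n + 2)) %/ 3)%N, 1%N, 0%N; lia.
  + by exists ((s - (2 * n + 1)) %/ 3)%N, 0%N, 1%N; lia.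
Qed.

(* Main.v *)
(* An ideal is determined by its least elements [3a], [n + 2 + 3b] and
   [2n + 1 + 3c] in the three residue classes modulo 3; its codimension is then
   [a + b + c], and being closed under the generators amounts to six linear
   inequalities between [a], [b] and [c] which are invariant under adding 1 to
   all three. This diagonal shift accounts for the factor [1 / (1 - q^3)]; what
   remains is the finite sum over the triples with [b = 0] or [c = 0], which is
   evaluated by geometric series. *)
Require Import Defs.
From mathcomp Require Import all_boot all_order all_algebra.
From mathcomp Require Import finmap zify ring.
From mathcomp Require Import boolp classical_sets cardinality.

Set Implicit Arguments.
Unset Strict Implicit.
Unset Printing Implicit Defensive.

Import GRing.Theory.
Local Open Scope classical_set_scope.
Local Open Scope ring_scope.

(** * Generating functions of weighted sets *)

Lemma card_fset_set_seq (T : choiceType) (A : set T) (s : seq T) :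
  uniq s -> (forall x, A x <-> x \in s) -> #|` fset_set A| = size s.
Proof.
move=> us As; have -> : A = [set` [fset x in s]%fset].
  by apply/seteqP; split=> x /=; rewrite !inE /= => /As.
by rewrite set_fsetK card_fseq undup_id.
Qed.

Lemma card_fset_set_image (T U : choiceType) (A : set T) (f : T -> U) :
  finite_set A -> (forall x y, A x -> A y -> f x = f y -> x = y) ->
  #|` fset_set [set f x | x in A]| = #|` fset_set A|.
Proof.
move=> fA injf; rewrite fset_set_image //; apply/eqP/card_in_imfsetP => x y.
by rewrite !in_fset_set // !inE; apply: injf.
Qed.

(* The generating function of the elements of [A] by weight; meaningful only
   when all [level A w k] are finite, since [fset_set] of an infinite set is
   empty. *)
Definition level (T : choiceType) (A : set T) (w : T -> nat) k : set T :=
  [set x | A x /\ w x = k].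

Definition weight_gf (T : choiceType) (A : set T) (w : T -> nat) : fps int :=
  FPS (fun k => #|` fset_set (level A w k)|%:Z).

(** Serves twice: with [d = 3] for the diagonal shift of triples, and with [d = 0] to carry the
    count from triples to ideals. *)
Lemma weight_gf_image (T U : choiceType) (A : set T) (w : T -> nat)
    (f : T -> U) (w' : U -> nat) (d : nat) :
  (forall k, finite_set (level A w k)) ->
  (forall x y, A x -> A y -> f x = f y -> x = y) ->
  (forall x, A x -> w' (f x) = (d + w x)%N) ->
  weight_gf [set f x | x in A] w' = fpsX int ^+ d * weight_gf A w.
Proof.
move=> finA injf wf; apply: fpsP => k.
have -> : fps_coef (fpsX int ^+ d * weight_gf A w) k =
    if (d <= k)%N then fps_coef (weight_gf A w) (k - d) else 0.
  elim: d {wf} k => [|d IHd] k; first by rewrite expr0 mul1r subn0.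
  by rewrite exprS -mulrA fps_coefXM; case: k => // k; rewrite IHd ltnS subSS.
rewrite /=; case: leqP => [dk|kd].
  have -> : level [set f x | x in A] w' k = [set f x | x in level A w (k - d)].
    apply/seteqP; split=> y /= [].
      by move=> [x Ax <-] wfx; exists x => //; split=> //; move: (wf x Ax); lia.
    by move=> x [Ax wx] <-; split; [exists x | rewrite wf // wx subnKC].
  by rewrite card_fset_set_image // => x y [Ax _] [Ay _]; apply: injf.
rewrite (@card_fset_set_seq _ _ [::]) // => y; split=> // -[[x Ax <-]].
by rewrite wf //; lia.
Qed.

Lemma weight_gfU (T : choiceType) (A B : set T) (w : T -> nat) :
  (forall k, finite_set (level A w k)) ->
  (forall k, finite_set (level B w k)) ->
  (forall x, A x -> B x -> False) ->
  weight_gf (A `|` B) w = weight_gf A w + weight_gf B w.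
Proof.
move=> finA finB AB; apply: fpsP => k /=.
have -> : level (A `|` B) w k = (level A w k `|` level B w k).
  apply/seteqP; split=> x /=.
    by move=> [[Ax|Bx] wx]; [left | right].
  by move=> [[Ax wx]|[Bx wx]]; split=> //; [left | right].
rewrite fset_setU // cardfsU; set C := (_ `&` _)%fset.
suff -> : C = fset0 by rewrite cardfs0 subn0 PoszD.
apply/fsetP => x; rewrite !inE !in_fset_set //.
by apply/andP => -[]; rewrite !inE => -[Ax _] [Bx _]; apply: AB Bx.
Qed.

Lemma weight_gf_seq (T : choiceType) (A : set T) (w : T -> nat) (s : seq T) :
  uniq s -> (forall x, A x <-> x \in s) ->
  weight_gf A w = \sum_(x <- s) fpsX int ^+ w x.
Proof.
move=> us As; apply: fpsP => k /=.
rewrite (@card_fset_set_seq _ _ [seq x <- s | w x == k]); first last.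
- move=> x; rewrite mem_filter; split.
    by move=> [/As -> ->]; rewrite eqxx.
  by move=> /andP[/eqP wx /As].
- exact: filter_uniq.
elim: s {us As} => [|x s IHs]; first by rewrite big_nil.
rewrite big_cons fps_coefD -IHs fps_coefXn /= [k == _]eq_sym.
by case: eqP; rewrite ?add0r //= -PoszD.
Qed.

(** * Admissible triples and their reduction to minimal ones *)

Section IdealsAsTriples.
Variable n : nat.

(** In order, the inequalities come from adding [n + 2] and then [2 * n + 1] to each of [3 * a],
    [n + 2 + 3 * b] and [2 * n + 1 + 3 * c]. For instance [2 * (n + 2) = 2 * n + 1 + 3] yields
    [c <= b + 1]. *)
Definition triple_ideal (t : nat * nat * nat) : Prop :=
  let: (a, b, c) := t in
  [&& b <= a, c <= a, c <= b + 1, a <= b + (n + 1), a <= c + (n + 1)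
    & b <= c + n]%N.

Definition triple_weight (t : nat * nat * nat) : nat := (t.1.1 + t.1.2 + t.2)%N.

Lemma finite_level_triple_weight (A : set (nat * nat * nat)) k :
  finite_set (level A triple_weight k).
Proof.
apply: (@sub_finite_set _ _ ((`I_k.+1 `*` `I_k.+1) `*` `I_k.+1)); last first.
  by do !apply: finite_setX; apply: finite_II.
by move=> [[a b] c] [_ <-]; rewrite /triple_weight /=; lia.
Qed.

Definition minimal_triple (t : nat * nat * nat) : Prop :=
  triple_ideal t /\ (t.1.2 = 0 \/ t.2 = 0)%N.

(* The case [a = 0] need not be listed in [minimal_triple]: it forces
   [b = c = 0]. *)
Lemma triple_gf_minimal :
  weight_gf triple_ideal triple_weight * (1 - fpsX int ^+ 3) =
  weight_gf minimal_triple triple_weight.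
Proof.
pose shift (t : nat * nat * nat) := (t.1.1.+1, t.1.2.+1, t.2.+1).
(* A triple with [b] and [c] positive is a shifted one. As [shift] raises the weight by 3, the
   generating functions satisfy T = M + q^3 T. *)
have E : triple_ideal = minimal_triple `|` [set shift t | t in triple_ideal].
  apply/seteqP; split=> [[[a b] c] V | _ [[] // | [[[a b] c] V <-]]].
    have [bc0|[b_gt0 c_gt0]] : (b = 0 \/ c = 0) \/ (0 < b /\ 0 < c)%N by lia.
      by left; split.
    have a_gt0 : (0 < a)%N by move: V => /=; lia.
    right; rewrite -(prednK a_gt0) -(prednK b_gt0) -(prednK c_gt0).
    by exists (a.-1, b.-1, c.-1) => //; move: V => /=; lia.
  by move: V; rewrite /=; lia.
rewrite mulrBr mulr1 {1}E weight_gfU; last first.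
- by move=> t [_ t0] [[[a b] c] _ tE]; move: t0; rewrite -tE /=; lia.
- exact: finite_level_triple_weight.
- exact: finite_level_triple_weight.
rewrite (@weight_gf_image _ _ _ triple_weight _ _ 3); first by ring.
- exact: finite_level_triple_weight.
- by move=> [[a b] c] [[a' b'] c'] _ _ [-> -> ->].
- by move=> [[a b] c] _; rewrite /triple_weight /=; lia.
Qed.

(* For [c = 0] the conditions read [b <= a <= n + 1], except that they exclude
   [a = b = n + 1]; for [b = 0 < c] they read [c = 1 <= a <= n + 1]. *)
Lemma minimal_triple_gf :
  weight_gf minimal_triple triple_weight + fpsX int ^+ (2 * n + 2) =
  \sum_(a < n + 2) \sum_(b < a.+1) fpsX int ^+ (a + b)
    + \sum_(a < n + 1) fpsX int ^+ (a + 2).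
Proof.
pose s1 := [seq (a, b, 0%N) | a <- iota 0 (n + 2), b <- iota 0 a.+1].
pose s2 := [seq (a.+1, 0%N, 1%N) | a <- iota 0 (n + 1)].
(* The point missing from the triangle [b <= a <= n + 1]; its weight [2 * n + 2] explains the extra
   power on the left. *)
pose corner := (n + 1, n + 1, 0)%N.
have s1P a b c : reflect (b <= a <= n + 1 /\ c = 0)%N ((a, b, c) \in s1).
  apply: (iffP allpairsPdep) => [[a' [b' []]]|[ab ->]].
    by rewrite !mem_iota => ? ? [-> -> ->]; lia.
  by exists a, b; rewrite !mem_iota; split=> //; lia.
have s2P a b c :
    reflect (0 < a <= n + 1 /\ b = 0 /\ c = 1)%N ((a, b, c) \in s2).
  apply: (iffP mapP) => [[a']|[an [-> ->]]].
    by rewrite mem_iota => ? [-> -> ->]; lia.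
  by exists a.-1; rewrite ?mem_iota; [lia | congr (_, _, _); lia].
transitivity (weight_gf (minimal_triple `|` [set corner]) triple_weight).
  rewrite weight_gfU; last first.
  - by move=> t [V _] tE; move: V; rewrite tE /=; lia.
  - exact: finite_level_triple_weight.
  - exact: finite_level_triple_weight.
  rewrite (@weight_gf_seq _ [set corner] _ [:: corner]) // => [|t].
    by rewrite big_seq1 /triple_weight /=; congr (_ + _ ^+ _); lia.
  by rewrite inE; split=> /eqP.
rewrite (@weight_gf_seq _ _ _ (s1 ++ s2)).
- have iotaE m : iota 0 m = index_iota 0 m by rewrite /index_iota subn0.
  rewrite big_cat big_allpairs_dep big_map !iotaE !big_mkord; congr (_ + _).
    apply: eq_bigr => a _; rewrite iotaE big_mkord.
    by apply: eq_bigr => b _; rewrite /triple_weight addn0.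
  by apply: eq_bigr => a _; rewrite /triple_weight /= addn0 addn1 addn2.
- rewrite cat_uniq; apply/and3P; split.
  + apply: allpairs_uniq_dep => [|a _|]; try exact: iota_uniq.
    by move=> [a b] [a' b'] _ _ [/= -> ->].
  + by rewrite -all_predC; apply/allP => -[[a b] c] /s2P ? /=; apply/s1P; lia.
  + by rewrite map_inj_uniq ?iota_uniq // => a b [].
- move=> [[a b] c]; rewrite mem_cat; split.
    move=> mt; apply/orP; case: mt => [[V bc0] | [-> -> ->]].
      by move: V bc0 => /= V [b0|c0]; case: (posnP c) => c1;
        [left | right | left | right]; (apply/s1P + apply/s2P); lia.
    by left; apply/s1P; lia.
  case/orP => [/s1P ab | /s2P ab]; last by left; split=> /=; lia.
  have [b1|b1] := eqVneq b (n + 1)%N.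
    by right; rewrite /corner /=; congr (_, _, _); lia.
  by left; split=> /=; lia.
Qed.

(** * The bijection between triples and ideals *)

Definition triple_set (t : nat * nat * nat) : set nat :=
  let: (a, b, c) := t in
  [set s | [|| (s == 0 %[mod 3]) && (3 * a <= s)%N,
    (s == n + 2 %[mod 3]) && (n + 2 + 3 * b <= s)%N |
    (s == 2 * n + 1 %[mod 3]) && (2 * n + 1 + 3 * c <= s)%N]].

(** Adding 3 stays in a residue class; each of the other six cases is one inequality of
    [triple_ideal]. *)
Lemma triple_set_step a b c s d : triple_ideal (a, b, c) ->
  triple_set (a, b, c) s -> [\/ d = 3, d = n + 2 | d = 2 * n + 1]%N ->
  triple_set (a, b, c) (s + d)%N.
Proof. by rewrite /= => V Ts [] ->; lia. Qed.

Lemma triple_set_addS a b c s d : triple_ideal (a, b, c) ->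
  triple_set (a, b, c) s -> semigroup3 3 (n + 2) (2 * n + 1) d ->
  triple_set (a, b, c) (s + d)%N.
Proof.
move=> V Ts [x [y [z ->]]]; rewrite addnA (addnA s).
have iter_step e m t : [\/ e = 3, e = n + 2 | e = 2 * n + 1]%N ->
    triple_set (a, b, c) t -> triple_set (a, b, c) (t + e * m)%N.
  move=> E Tt; elim: m => [|m IHm]; first by rewrite muln0 addn0.
  by rewrite mulnS addnCA addnC; apply: triple_set_step.
apply: (iter_step); first exact: Or33.
apply: (iter_step); first exact: Or32.
by apply: (iter_step) => //; apply: Or31.
Qed.

Hypothesis n_mod3 : n <> 1 %[mod 3].

(** Since [n] is not 1 modulo 3, the residues of [0], [n + 2] and [2 * n + 1] are distinct, so only
    one disjunct of [triple_set] can hold for a given element. *)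
Lemma triple_set_mul3 a b c j : triple_set (a, b, c) (3 * j)%N <-> (a <= j)%N.
Proof. by rewrite /=; lia. Qed.

Lemma triple_set_addn2 a b c j :
  triple_set (a, b, c) (n + 2 + 3 * j)%N <-> (b <= j)%N.
Proof. by rewrite /=; lia. Qed.

Lemma triple_set_add2n1 a b c j :
  triple_set (a, b, c) (2 * n + 1 + 3 * j)%N <-> (c <= j)%N.
Proof. by rewrite /=; lia. Qed.

Lemma semigroup3E : semigroup3 3 (n + 2) (2 * n + 1) = triple_set (0, 0, 0)%N.
Proof.
apply/seteqP; split=> s.
  (* The element [s] of the semigroup is added to [0], which lies in [triple_set (0, 0, 0)]. *)
  by rewrite -{2}[s]add0n; apply: triple_set_addS => //=; lia.
rewrite /= => /or3P[] /andP[/eqP s3 sge].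
- by exists (s %/ 3)%N, 0%N, 0%N; lia.
- by exists ((s - (n + 2)) %/ 3)%N, 1%N, 0%N; lia.
- by exists ((s - (2 * n + 1)) %/ 3)%N, 0%N, 1%N; lia.
Qed.

Lemma is_ideal_triple_set t : triple_ideal t ->
  is_ideal (semigroup3 3 (n + 2) (2 * n + 1)) (triple_set t).
Proof.
move: t => [[a b] c] V; split.
- by exists (3 * a)%N => /=; lia.
- by rewrite semigroup3E => s /=; lia.
- by move=> x s Tx Ss; apply: triple_set_addS.
Qed.

Lemma triple_set_inj t u : triple_set t = triple_set u -> t = u.
Proof.
move: t u => [[a b] c] [[a' b'] c'] E.
have leq_eq m m' : (forall j, m <= j <-> m' <= j)%N -> m = m'.
  by move=> mm'; apply/eqP; rewrite eqn_leq; apply/andP; split; apply/mm'.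
congr (_, _, _); apply: leq_eq => j.
- by rewrite -(triple_set_mul3 a b c) E triple_set_mul3.
- by rewrite -(triple_set_addn2 a b c) E triple_set_addn2.
- by rewrite -(triple_set_add2n1 a b c) E triple_set_add2n1.
Qed.

(** The complement consists of three progressions of step 3, of lengths [a], [b] and [c], disjoint
    because their residues differ. *)
Lemma codim_triple_set t :
  codim (semigroup3 3 (n + 2) (2 * n + 1)) (triple_set t) = triple_weight t.
Proof.
move: t => [[a b] c]; rewrite semigroup3E /codim /triple_weight /=.
pose gaps r m := [seq (r + 3 * i)%N | i <- iota 0 m].
have gapsP r m s :
    reflect (s = r %[mod 3] /\ r <= s < r + 3 * m)%N (s \in gaps r m).
  apply: (iffP mapP) => [[i]|[s3 sm]]; first by rewrite mem_iota => ? ->; lia.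
  by exists ((s - r) %/ 3)%N; rewrite ?mem_iota; lia.
have gaps_uniq r m : uniq (gaps r m).
  by rewrite map_inj_uniq ?iota_uniq // => i j; lia.
rewrite (@card_fset_set_seq _ _
  (gaps 0 a ++ gaps (n + 2) b ++ gaps (2 * n + 1) c)%N).
- by rewrite !size_cat !size_map !size_iota addnA.
- rewrite !cat_uniq !gaps_uniq /= andbT -!all_predC all_cat.
  apply/andP; split; [apply/andP; split |];
    by apply/allP => s /gapsP s1 /=; apply/gapsP; lia.
- move=> s; rewrite !mem_cat; split.
    move=> /= [S0 /negP ST]; apply/or3P.
    have [s3|[s3|s3]] : (s = 0 %[mod 3] \/ s = n + 2 %[mod 3] \/
      s = 2 * n + 1 %[mod 3])%N by lia.
    + by apply: Or31; apply/gapsP; lia.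
    + by apply: Or32; apply/gapsP; lia.
    + by apply: Or33; apply/gapsP; lia.
  by case/or3P => /gapsP [s3 sm]; split=> /=; rewrite ?(rwP negP); lia.
Qed.

Lemma upward_closed_threshold (I : set nat) r :
  (forall x, I x -> I (x + 3)%N) -> (exists j, I (r + 3 * j)%N) ->
  exists m, forall j, I (r + 3 * j)%N <-> (m <= j)%N.
Proof.
move=> I3 [j0 Ij0].
have exI : exists j, `[< I (r + 3 * j)%N >] by exists j0; apply/asboolP.
case: (ex_minnP exI) => m /asboolP Im mmin; exists m => j; split.
  by move=> Ij; apply/mmin/asboolP.
move=> /subnKC <-; elim: (j - m)%N => [|i IHi]; first by rewrite addn0.
by rewrite addnS mulnS [(3 + _)%N]addnC addnA; apply: I3.
Qed.

(** The coordinates are the thresholds of [I] along the three progressions. Adding a generator to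
    the least element of one class and comparing with the threshold of the class reached gives each
    inequality. *)
Lemma ideal_triple_set I : is_ideal (semigroup3 3 (n + 2) (2 * n + 1)) I ->
  exists2 t, triple_ideal t & triple_set t = I.
Proof.
move=> [[i Ii] IS ID].
have I3 x : I x -> I (x + 3)%N.
  by move=> Ix; apply: ID => //; exists 1, 0, 0; lia.
have Ib x : I x -> I (x + (n + 2))%N.
  by move=> Ix; apply: ID => //; exists 0, 1, 0; lia.
have Ic x : I x -> I (x + (2 * n + 1))%N.
  by move=> Ix; apply: ID => //; exists 0, 0, 1; lia.
(* One of [i], [i + (n + 2)], [i + (2 * n + 1)] is congruent to [r]; adding [3 * r] preserves the
   class and makes the element at least [r]. *)
have nonempty r : exists j, I (r + 3 * j)%N.
  have I3r : I (i + 3 * r)%N by apply: ID => //; exists r, 0, 0; lia.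
  have [r3|[r3|r3]] : (r = i %[mod 3] \/ r = i + (n + 2) %[mod 3] \/
    r = i + (2 * n + 1) %[mod 3])%N by lia.
  - exists ((i + 2 * r) %/ 3)%N; move: I3r; congr (I _); lia.
  - exists ((i + (n + 2) + 2 * r) %/ 3)%N; move: (Ib _ I3r); congr (I _); lia.
  - exists ((i + (2 * n + 1) + 2 * r) %/ 3)%N.
    by move: (Ic _ I3r); congr (I _); lia.
have [a Ia] := upward_closed_threshold I3 (nonempty 0).
have [b Ibb] := upward_closed_threshold I3 (nonempty (n + 2)%N).
have [c Icc] := upward_closed_threshold I3 (nonempty (2 * n + 1)%N).
exists (a, b, c).
  have Iab : I (3 * a)%N by apply/(Ia a).
  have Ibs : I (n + 2 + 3 * b)%N by apply/(Ibb b).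
  have Ics : I (2 * n + 1 + 3 * c)%N by apply/(Icc c).
  have ba : (b <= a)%N.
    by apply/Ibb; move: (Ib _ Iab); congr (I _); lia.
  have ca : (c <= a)%N.
    by apply/Icc; move: (Ic _ Iab); congr (I _); lia.
  have cb : (c <= b + 1)%N.
    by apply/Icc; move: (Ib _ Ibs); congr (I _); lia.
  have ab : (a <= b + (n + 1))%N.
    by apply/Ia; move: (Ic _ Ibs); congr (I _); lia.
  have ac : (a <= c + (n + 1))%N.
    by apply/Ia; move: (Ib _ Ics); congr (I _); lia.
  have bc : (b <= c + n)%N.
    by apply/Ibb; move: (Ic _ Ics); congr (I _); lia.
  by rewrite /= ba ca cb ab ac bc.
apply/seteqP; split=> s.
  case/or3P => /andP[/eqP s3 sge].
  - have -> : (s = 0 + 3 * (s %/ 3))%N by lia.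
    by apply/Ia; lia.
  - have -> : (s = n + 2 + 3 * ((s - (n + 2)) %/ 3))%N by lia.
    by apply/Ibb; lia.
  - have -> : (s = 2 * n + 1 + 3 * ((s - (2 * n + 1)) %/ 3))%N by lia.
    by apply/Icc; lia.
(* Membership in the semigroup puts [s] at or above the start of its progression, so the truncated
   subtractions below are exact. *)
move=> Is; have := IS _ Is; rewrite semigroup3E.
case/or3P => /andP[/eqP s3 sge] /=.
- have /Ia : I (0 + 3 * (s %/ 3))%N by move: Is; congr (I _); lia.
  by lia.
- have /Ibb : I (n + 2 + 3 * ((s - (n + 2)) %/ 3))%N.
    by move: Is; congr (I _); lia.
  by lia.
- have /Icc : I (2 * n + 1 + 3 * ((s - (2 * n + 1)) %/ 3))%N.
    by move: Is; congr (I _); lia.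
  by lia.
Qed.

Lemma ideal_gf_triple :
  ideal_gf (semigroup3 3 (n + 2) (2 * n + 1)) =
  weight_gf triple_ideal triple_weight.
Proof.
set S := semigroup3 _ _ _.
have -> : ideal_gf S = weight_gf (is_ideal S) (codim S) by [].
have -> : is_ideal S = [set triple_set t | t in triple_ideal].
  apply/seteqP; split=> [I /ideal_triple_set [t Vt <-] | _ [t Vt <-]].
    by exists t.
  exact: is_ideal_triple_set.
rewrite (@weight_gf_image _ _ _ triple_weight _ _ 0) ?mul1r //.
- exact: finite_level_triple_weight.
- by move=> t u _ _; apply: triple_set_inj.
- by move=> t _; apply: codim_triple_set.
Qed.

End IdealsAsTriples.

(** * Evaluation of the sums and the closed formula *)

Lemma sum_expr_triangle (R : comNzRingType) (x : R) m :
  (1 - x) ^+ 2 * (1 + x) * (\sum_(a < m) \sum_(b < a.+1) x ^+ (a + b)) =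
  (1 - x ^+ m) * (1 - x ^+ m.+1).
Proof.
(* The double sum is the Gaussian binomial of [m + 1] over 2; the induction adds the row [a = m], a
   geometric sum. *)
elim: m => [|m IHm]; first by rewrite big_ord0 subrr mulr0 mul0r.
rewrite big_ord_recr mulrDr IHm /=.
have -> : \sum_(b < m.+1) x ^+ (m + b) = x ^+ m * \sum_(b < m.+1) x ^+ b.
  by rewrite mulr_sumr; apply: eq_bigr => b _; rewrite exprD.
(* A factor [1 - x] is turned into [x - 1], the form in which [subrX1] collapses the sum. *)
have -> : (1 - x) ^+ 2 * (1 + x) * (x ^+ m * \sum_(b < m.+1) x ^+ b) =
    - ((1 - x) * (1 + x) * x ^+ m) * ((x - 1) * \sum_(b < m.+1) x ^+ b) by ring.
by rewrite -subrX1 !exprS; ring.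
Qed.

Theorem theorem4p4 (n : nat) (n_gt0 : (0 < n)%N) (n_mod3 : n <> 1 %[mod 3]) :
  let q : fps int := fpsX int in
  ideal_gf (semigroup3 3 (n + 2) (2 * n + 1)) =
  1 / (1 - q ^+ 3) *
  (1
   + (q * (q ^+ (n + 1) - 1) * (2 * q ^+ (n + 3) + q ^+ 2 - 2 * q - 1)
      - q ^+ 4 * (q ^+ (2 * n + 1) - q ^+ (n + 1) - q ^+ n + 1))
     / ((1 - q) ^+ 2 * (1 + q))
   - q ^+ (2 * n + 2)).
Proof.
move=> q; set D := (1 - q) ^+ 2 * (1 + q).
(* Both denominators have constant term 1, so the divisions are by genuine units. *)
have q3_unit : 1 - q ^+ 3 \is a GRing.unit.
  by rewrite fps_unitE fps_coefB fps_coefXn subr0 unitr1.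
have D_unit : D \is a GRing.unit.
  by rewrite unitrM unitrX !fps_unitE ?fps_coefB ?fps_coefD /= ?subr0 ?addr0.
rewrite ideal_gf_triple // div1r [RHS]mulrC; apply: canRL (mulrK q3_unit) _.
rewrite triple_gf_minimal.
(* The corner term completes the triangle on the left and cancels the last term on the right. *)
apply: (addIr (q ^+ (2 * n + 2))); rewrite minimal_triple_gf // subrK.
(* With [D] cleared and the sums evaluated, a polynomial identity in powers of [q] remains. *)
apply: (mulIr D_unit); rewrite [RHS]mulrDl divrK // mul1r [LHS]mulrC mulrDr.
rewrite {1}/D sum_expr_triangle.
have -> : \sum_(a < n + 1) q ^+ (a + 2) = q ^+ 2 * \sum_(a < n + 1) q ^+ a.
  by rewrite mulr_sumr; apply: eq_bigr => a _; rewrite addnC exprD.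
have -> : D * (q ^+ 2 * \sum_(a < n + 1) q ^+ a) =
    - ((1 - q) * (1 + q) * q ^+ 2) * ((q - 1) * \sum_(a < n + 1) q ^+ a).
  by rewrite /D; ring.
by rewrite -subrX1 /D !addnS !addn0 mul2n -addnn !exprS exprD; ring.
Qed.
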